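(* Every injective monoid endomorphism of the semigroup $\boldsymbol{B}_{\omega}^{\mathscr{F}^4}$ is the identity transformation.
   Context: $\omega$ denotes the set of all non-negative integers, and for $a\in\omega$ put $[a)=\{x\in\omega\colon x\geqslant a\}$. For an integer $n$ and a set $F\subseteq\omega$ put $n+F=\{n+k\colon k\in F\}$ (a subset of $\mathbb{Z}$). The family $\mathscr{F}^4=\{[0),[1),[2),[3)\}$. The semigroup $\boldsymbol{B}_{\omega}^{\mathscr{F}^4}$ is the set $\omega\times\omega\times\mathscr{F}^4$ of triples $(i,j,F)$ with the operation $$(i_1,j_1,F_1)\cdot(i_2,j_2,F_2)=\begin{cases}(i_1-j_1+i_2,\,j_2,\,(j_1-i_2+F_1)\cap F_2), & \text{if } j_1\leqslant i_2;\\ (i_1,\,j_1-i_2+j_2,\,F_1\cap(i_2-j_1+F_2)), & \text{if } j_1\geqslant i_2.\end{cases}$$ It is a monoid with identity element $(0,0,[0))$. An endomorphism of a semigroup $S$ is a homomorphism $S\to S$; a monoid endomorphism is an endomorphism that maps the identity element to itself. *)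

(* Defs.v *)
From HB Require Import structures.
From mathcomp Require Import all_boot all_order all_algebra.
From mathcomp Require Import boolp classical_sets.
From mathcomp Require Import zify.

Set Implicit Arguments.
Unset Strict Implicit.
Unset Printing Implicit Defensive.

Import Order.TTheory GRing.Theory Num.Theory.
Local Open Scope classical_set_scope.

Definition ray (a : nat) : set nat := [set x | (a <= x)%N].

Definition F4 : set (set nat) := [set ray 0; ray 1; ray 2; ray 3].

Definition shift (n : int) (F : set nat) : set int :=
  [set (n + k%:Z)%R | k in F].

(* Intersecting a subset of the integers with a subset of nat lands in nat,
   hence the preimages by the embedding Posz of nat into int. *)
Definition mul_set (j1 i2 : nat) (F1 F2 : set nat) : set nat :=
  if (j1 <= i2)%N then Posz @^-1` shift (j1%:Z - i2%:Z)%R F1 `&` F2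
  else F1 `&` Posz @^-1` shift (i2%:Z - j1%:Z)%R F2.

Lemma F4P (F : set nat) : F4 F <-> exists2 a, (a < 4)%N & F = ray a.
Proof.
split=> [[[[->|->]|->]|->]|].
- by exists 0.
- by exists 1.
- by exists 2.
- by exists 3.
- by case=> -[|[|[|[|//]]]] _ ->; rewrite /F4 /=; tauto.
Qed.

Lemma preimage_shift_ray (n : int) (a k : nat) :
  (Posz @^-1` shift n (ray a)) k <-> (n + a%:Z <= k%:Z)%R.
Proof.
rewrite /shift /ray /=; split=> [[x /= ax <-]|nak]; first by lia.
by exists `|(k%:Z - n)%R|%N => /=; lia.
Qed.

Lemma mul_set_ray (j1 i2 a b : nat) :
  mul_set j1 i2 (ray a) (ray b) =
  ray (if (j1 <= i2)%N then maxn (a - (i2 - j1)) b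
       else maxn a (b - (j1 - i2))).
Proof.
apply/seteqP; rewrite /mul_set; case: leqP => ji; split=> k.
- by case=> /preimage_shift_ray; rewrite /ray /=; lia.
- by rewrite {1}/ray /= => h; split; [apply/preimage_shift_ray|rewrite /ray /=]; lia.
- by case=> + /preimage_shift_ray; rewrite /ray /=; lia.
- by rewrite {1}/ray /= => h; split; [rewrite /ray /=|apply/preimage_shift_ray]; lia.
Qed.

Lemma mul_set_in_F4 (j1 i2 : nat) (F1 F2 : F4) :
  mul_set j1 i2 (val F1) (val F2) \in F4.
Proof.
have /set_mem/F4P[a a4 ->] := valP F1; have /set_mem/F4P[b b4 ->] := valP F2.
by apply/mem_set/F4P; rewrite mul_set_ray; case: leqP => _; (eexists; last by []); lia.
Qed.

Definition BF4 : Type := (nat * nat * F4)%type.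

HB.instance Definition _ := Choice.on BF4.

(* Each truncated subtraction of nat below is taken in the direction in which
   it is exact. *)
Definition mulB (x y : BF4) : BF4 :=
  let: (i1, j1, F1) := x in
  let: (i2, j2, F2) := y in
  let F : F4 := SigSub (mul_set_in_F4 j1 i2 F1 F2) in
  if (j1 <= i2)%N then (i1 + (i2 - j1), j2, F)%N
  else (i1, (j1 - i2) + j2, F)%N.

Lemma ray0_in_F4 : ray 0 \in F4.
Proof. by apply/mem_set/F4P; exists 0. Qed.

Definition oneB : BF4 := (0%N, 0%N, SigSub ray0_in_F4).

Lemma BF4_eq (x y : BF4) : x.1 = y.1 -> val x.2 = val y.2 -> x = y.
Proof. by case: x y => [p F] [q G] /= -> /val_inj ->. Qed.

Lemma mulB1E (x y : BF4) : (mulB x y).1 =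
  if (x.1.2 <= y.1.1)%N then (x.1.1 + (y.1.1 - x.1.2), y.1.2)%N
  else (x.1.1, (x.1.2 - y.1.1) + y.1.2)%N.
Proof. by case: x y => [[i1 j1] F1] [[i2 j2] F2] /=; case: leqP. Qed.

Lemma mulB2E (x y : BF4) :
  val (mulB x y).2 = mul_set x.1.2 y.1.1 (val x.2) (val y.2).
Proof. by case: x y => [[i1 j1] F1] [[i2 j2] F2] /=; case: leqP. Qed.

(* The two cases of the product overlap when j1 = i2, and they agree there. *)
Lemma mulB_ge (i1 j1 i2 j2 : nat) (F1 F2 : F4) : (i2 <= j1)%N ->
  (mulB (i1, j1, F1) (i2, j2, F2)).1 = (i1, (j1 - i2) + j2)%N /\
  val (mulB (i1, j1, F1) (i2, j2, F2)).2 =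
    val F1 `&` Posz @^-1` shift (i2%:Z - j1%:Z)%R (val F2).
Proof.
move=> ij; rewrite mulB1E mulB2E /= /mul_set; case: leqP => // ji.
have -> : j1 = i2 by lia.
rewrite subnn addn0 add0n subrr; split=> //.
have shift0 (F : set nat) : Posz @^-1` shift 0 F = F.
  rewrite /shift; apply/seteqP; split=> k /=; last by exists k; rewrite ?add0r.
  by case=> x Fx; rewrite add0r => -[<-].
by rewrite !shift0.
Qed.

Lemma mulBA : associative mulB.
Proof.
move=> [[i1 j1] [F1 hF1]] [[i2 j2] [F2 hF2]] [[i3 j3] [F3 hF3]].
have /set_mem/F4P[a _ eF1] := hF1.
have /set_mem/F4P[b _ eF2] := hF2.
have /set_mem/F4P[c _ eF3] := hF3.
apply: BF4_eq; rewrite ?mulB2E !mulB1E.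
  rewrite /=.
  case: (leqP j1 i2) => ?; case: (leqP j2 i3) => ? /=; repeat (case: leqP => ? /=);
  by congr pair; lia.
rewrite /= eF1 eF2 eF3 !mul_set_ray; congr ray.
by case: (leqP j1 i2) => ?; case: (leqP j2 i3) => ? /=; repeat (case: ifP => ? /=); lia.
Qed.

Lemma mul1B : left_id oneB mulB.
Proof.
move=> [[i j] [F hF]]; have /set_mem/F4P[a _ eF] := hF.
apply: BF4_eq; first by rewrite mulB1E /=; congr pair; lia.
by rewrite mulB2E /= eF mul_set_ray; congr ray; lia.
Qed.

Lemma mulB1 : right_id oneB mulB.
Proof.
move=> [[i j] [F hF]]; have /set_mem/F4P[a _ eF] := hF.
apply: BF4_eq; first by rewrite mulB1E /=; case: leqP => ? /=; congr pair; lia.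
by rewrite mulB2E /= eF mul_set_ray; case: leqP => ?; congr ray; lia.
Qed.

HB.instance Definition _ := isMonoid.Build BF4 mulBA mul1B mulB1.

(* Main.v *)
Require Import Defs.
From mathcomp Require Import all_boot.
From mathcomp Require Import boolp classical_sets zify.

(** Under [(i, j, [a))] |-> [(i, j, i + a, j + a)] the monoid embeds into the
square of the bicyclic monoid. Write [p = (1, 0, [0))], [q = (0, 1, [0))] and
[e_a = (0, 0, [a))], so that [(i, j, [a)) = p^i e_a q^j]. As [q p = 1], an
injective monoid endomorphism [f] sends [p] and [q] to [(k, 0, [0))] and
[(0, k, [0))] for some [k > 0], and [e_a] to an idempotent [(m_a, m_a, [t_a))].
The relation [e_(a+1) p q = p e_a q] gives [max(m_(a+1), k) = m_a + k] and
[t_(a+1) - (k - m_(a+1)) = t_a]; if [m_(a+1) >= k] then [f] identifies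
[e_(a+1)] and [p e_a q]. Hence [m_(a+1) < k], so [m_1 = m_2 = 0], and
[t_3 = t_1 + k + (k - m_3)] is a sum of three positive terms bounded by 3. *)

Lemma ray_min_in_F4 (a : nat) : ray (minn a 3) \in F4.
Proof. by apply/mem_set/F4P; exists (minn a 3); first lia. Qed.

(* The cap at 3 makes [elB] total; it represents [(i, j, [a))] for [a < 4]. *)
Definition elB (i j a : nat) : BF4 := (i, j, SigSub (ray_min_in_F4 a)).

Lemma ray_inj : injective ray.
Proof.
move=> a b eq_ab; apply/eqP; rewrite eqn_leq; apply/andP; split.
- have : ray b b by apply: leqnn.
  by rewrite -eq_ab.
- have : ray a a by apply: leqnn.
  by rewrite eq_ab.
Qed.

Lemma elB_inj (i j a i' j' a' : nat) : a < 4 -> a' < 4 ->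
  elB i j a = elB i' j' a' -> [/\ i = i', j = j' & a = a'].
Proof. by move=> a4 a'4 [-> -> /ray_inj eq_a]; split=> //; lia. Qed.

Lemma elB_ex (x : BF4) : exists i j a, a < 4 /\ x = elB i j a.
Proof.
case: x => [[i j] F]; have /set_mem/F4P[a a4 eF] := valP F.
exists i, j, a; split=> //; apply: BF4_eq => //=.
by rewrite eF; congr ray; lia.
Qed.

(** One of the truncated differences [i2 - j1] and [j1 - i2] is always 0, which merges the two cases
    of the product. *)
Lemma mul_elB (i1 j1 a i2 j2 b : nat) : a < 4 -> b < 4 ->
  mulB (elB i1 j1 a) (elB i2 j2 b) =
  elB (i1 + (i2 - j1)) (j1 - i2 + j2) (maxn (a - (i2 - j1)) (b - (j1 - i2))).
Proof.
move=> a4 b4; apply: BF4_eq.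
  by rewrite mulB1E /=; case: leqP => ?; congr pair; lia.
by rewrite mulB2E /= mul_set_ray; case: leqP => ?; congr ray; lia.
Qed.

Lemma oneBE : oneB = elB 0 0 0.
Proof. exact: BF4_eq. Qed.

Lemma elB_split (i j a : nat) : a < 4 ->
  elB i j a = mulB (mulB (elB i 0 0) (elB 0 0 a)) (elB 0 j 0).
Proof. by move=> a4; rewrite !mul_elB //; try congr elB; lia. Qed.

Lemma elB_left_inverse (x y : BF4) : mulB x y = oneB ->
  exists k, x = elB 0 k 0 /\ y = elB k 0 0.
Proof.
have [i [j [a [a4 ->]]]] := elB_ex x; have [i' [j' [b [b4 ->]]]] := elB_ex y.
rewrite oneBE mul_elB // => /elB_inj-[|//|i0 j0 ab0]; first lia.
by exists j; split; congr elB; lia.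
Qed.

Lemma elB_idempotent (x : BF4) : mulB x x = x ->
  exists m t, t < 4 /\ x = elB m m t.
Proof.
have [i [j [a [a4 ->]]]] := elB_ex x.
rewrite mul_elB // => /elB_inj-[|//|ii jj _]; first lia.
by exists i, a; split=> //; congr elB; lia.
Qed.

Theorem theorem2p10 (f : BF4 -> BF4)
  (f_morph : monoid.monoid_morphism f) (f_inj : injective f) : f = id.
Proof.
have f1 : f oneB = oneB by case: f_morph.
have fM x y : f (mulB x y) = mulB (f x) (f y) by case: f_morph => _; apply.
have [k [fq fp]] : exists k, f (elB 0 1 0) = elB 0 k 0 /\ f (elB 1 0 0) = elB k 0 0.
  by apply: elB_left_inverse; rewrite -fM mul_elB // -oneBE f1.
have fpn n : f (elB n 0 0) = elB (k * n) 0 0.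
  elim: n => [|n IH]; first by rewrite -oneBE f1 oneBE muln0.
  have -> : elB n.+1 0 0 = mulB (elB 1 0 0) (elB n 0 0).
    by rewrite mul_elB //; congr elB; lia.
  by rewrite fM fp IH mul_elB //; congr elB; lia.
have fqn n : f (elB 0 n 0) = elB 0 (k * n) 0.
  elim: n => [|n IH]; first by rewrite -oneBE f1 oneBE muln0.
  have -> : elB 0 n.+1 0 = mulB (elB 0 n 0) (elB 0 1 0).
    by rewrite mul_elB //; congr elB; lia.
  by rewrite fM fq IH mul_elB //; congr elB; lia.
have k_gt0 : 0 < k.
  case: k fq {fp fpn fqn} => // fq.
  have /f_inj/elB_inj : f (elB 0 1 0) = f (elB 0 0 0) by rewrite fq -oneBE f1.
  by case.
have fe a : a < 4 -> exists m t, t < 4 /\ f (elB 0 0 a) = elB m m t.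
  move=> a4; apply: elB_idempotent.
  by rewrite -fM mul_elB //; congr f; congr elB; lia.
have fE i j a m t : a < 4 -> t < 4 -> f (elB 0 0 a) = elB m m t ->
    f (elB i j a) = elB (k * i + m) (k * j + m) t.
  by move=> a4 t4 fa; rewrite elB_split // !fM fa fpn fqn !mul_elB; try congr elB; lia.
have step a m t m' t' : a < 3 -> t < 4 -> t' < 4 ->
    f (elB 0 0 a) = elB m m t -> f (elB 0 0 a.+1) = elB m' m' t' ->
    [/\ maxn m' k = k + m, t' - (k - m') = t & m' < k].
  move=> a3 t4 t'4 fa fa'.
  have a4 : a < 4 by lia.
  have f11 := fE 1 1 a m t a4 t4 fa.
  have : f (mulB (elB 0 0 a.+1) (elB 1 1 0)) = f (elB 1 1 a).
    by rewrite mul_elB //; congr f; congr elB; lia.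
  rewrite fM fa' (fE 1 1 0 0 0) //; last by rewrite -oneBE f1 oneBE.
  rewrite f11 mul_elB // => /elB_inj-[||eqi _ eqt]; [lia|lia|].
  (* If [k <= m'], then [eqi] and [eqt] become [m' = k + m] and [t' = t]. *)
  split; [lia|lia|rewrite ltnNge; apply/negP => km'].
  have /f_inj/elB_inj : f (elB 0 0 a.+1) = f (elB 1 1 a).
    by rewrite fa' f11; congr elB; lia.
  by case.
have fe0 : f (elB 0 0 0) = elB 0 0 0 by rewrite -oneBE f1.
have [m1 [t1 [t14 fe1]]] := fe 1 isT.
have [m2 [t2 [t24 fe2]]] := fe 2 isT.
have [m3 [t3 [t34 fe3]]] := fe 3 isT.
have [M1 T1 L1] := step 0 0 0 _ _ isT isT t14 fe0 fe1.
have [M2 T2 L2] := step 1 _ _ _ _ isT t14 t24 fe1 fe2.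
have [M3 T3 L3] := step 2 _ _ _ _ isT t24 t34 fe2 fe3.
(* [T1] gives only [t1 <= k], so positivity needs injectivity: [M2] and [L2] force [m1 = 0]. It
   makes the truncated subtractions in [T2] and [T3] exact. *)
have t1_gt0 : 0 < t1.
  rewrite lt0n; apply/eqP => t10.
  have /f_inj/elB_inj : f (elB 0 0 1) = f (elB 0 0 0).
    by rewrite fe1 fe0; congr elB; lia.
  by case.
(* The bound [t3 < 4] forces [t1 = k = k - m3 = 1], whence [m3 = 0], [t2 = 2] and [t3 = 3]. *)
have fe_id a : a < 4 -> f (elB 0 0 a) = elB 0 0 a.
  by case: a => [|[|[|[|//]]]] _; rewrite ?fe0 ?fe1 ?fe2 ?fe3; congr elB; lia.
apply/funext => x; have [i [j [a [a4 ->]]]] := elB_ex x.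
have k1 : k = 1 by lia.
by rewrite (fE i j a 0 a) ?fe_id ?k1 //; congr elB; lia.
Qed.
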